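(* Let $(X_i)_{i=1}^\infty$ be independent with $X_i\sim\mathrm{Exp}(i)$ and $M=\sup_{i\ge1}X_i$. Then as $m\to\infty$, $$P(X_m=M)=\pi\sqrt{2m}\;e^{-\pi\sqrt{2/3}\,\sqrt m}\,(1+o(1)).$$
   Context: $\mathrm{Exp}(\lambda)$ denotes the exponential distribution with rate $\lambda$ (density $\lambda e^{-\lambda x}$, $x\ge0$). *)

(* Defs.v *)
From HB Require Import structures.
From mathcomp Require Import all_boot all_order all_algebra finmap.
From mathcomp Require Import all_classical all_reals all_analysis.
Set Implicit Arguments. Unset Strict Implicit. Unset Printing Implicit Defensive.
Import Order.TTheory GRing.Theory Num.Theory.
Local Open Scope classical_set_scope.
Local Open Scope ring_scope.

Definition mutually_independent_RVs {d} {T : measurableType d} {R : realType}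
  (P : probability T R) (I : set nat) (X : nat -> {RV P >-> R}) : Prop :=
  forall (J : {fset nat}) (B : nat -> set R),
    [set` J] `<=` I -> (forall j, j \in J -> measurable (B j)) ->
    P (\bigcap_(j in [set` J]) (X j @^-1` B j)) =
      (\prod_(j <- J) P (X j @^-1` B j))%E.
Arguments mutually_independent_RVs {d T R} P I X.

(* Main.v *)
Require Import Defs.
From HB Require Import structures.
From mathcomp Require Import all_boot all_order all_algebra finmap.
From mathcomp Require Import all_classical all_reals all_analysis.
From mathcomp Require Import measurable_realfun ring lra zify.
Set Implicit Arguments. Unset Strict Implicit. Unset Printing Implicit Defensive.
Import Order.TTheory GRing.Theory Num.Theory.
Import numFieldTopology.Exports numFieldNormedType.Exports.
Local Open Scope classical_set_scope.
Local Open Scope ring_scope.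

(** Write [V_i = exp (- X_i)], so that [V_i <= t] has probability [t ^ i], and
    let [F_N = \prod_(1 <= i <= N) (1 - t ^ i)].  Then [X_m] is the largest of
    [X_1, ..., X_N] with probability
    [m \int_0^1 t^(m-1) F_N / (1 - t^m) dt]; expanding the geometric series,
    this is [\sum_(j >= 1) g (j m) / j] where [g s = s \int_0^1 t^(s-1) F_N dt].
    As [N] grows, the pentagonal number theorem (in the finite form of Shanks,
    which has an explicit remainder) turns [g s] into
    [\sum_k (-1)^k s / (s + k (3 k + 1) / 2)], an alternating sum of Lorentzians
    whose closed form is the imaginary part of the partial fraction expansion of
    [1 / sin].  The closed form shows that [g s] is equivalent to
    [pi sqrt (2 s) exp (- pi sqrt (2 s / 3))], so the term [j = 1] dominates.
    The expansion of [1 / sin] is obtained by iterating its triplication formula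
    [r] times, which gives an exact sum of [3 ^ r] terms, hence the truncation
    indices [(3 ^ r - 1) / 2] at which all limits are taken. *)

(** * Primitives of polynomials and Shanks' identity *)

Lemma MVT_derive (R : realType) (f df : R -> R) a b :
  (forall x : R, is_derive x (1 : R) f (df x)) -> a <= b ->
  exists2 c, a <= c <= b & f b - f a = df c * (b - a).
Proof.
move=> fdf ab; have [] // := @MVT_segment R f df a b ab; last first.
  by move=> c; rewrite in_itv /= => cab e; exists c.
apply: continuous_subspaceT => x; apply: differentiable_continuous.
by apply/derivable1_diffP; have [] := fdf x.
Qed.

Section PolynomialPrimitive.
Variable R : realType.
Implicit Types p q : {poly R}.

(* The coefficient of degree 0 is [p`_0 / 0 = 0]. *)
Definition prim p : {poly R} := \poly_(i < (size p).+1) (p`_i.-1 / i%:R).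

Lemma coef_prim p i : (prim p)`_i = p`_i.-1 / i%:R.
Proof.
rewrite coef_poly; case: ltnP => // sp.
by case: i sp => [|i] // sp; rewrite nth_default ?mul0r.
Qed.

Lemma deriv_prim p : (prim p)^`() = p.
Proof.
by apply/polyP => i; rewrite coef_deriv coef_prim /= -[LHS]mulr_natr divfK ?pnatr_eq0.
Qed.

Lemma prim_le p q a b : a <= b ->
  (forall x, a <= x <= b -> p.[x] <= q.[x]) ->
  (prim p).[b] - (prim p).[a] <= (prim q).[b] - (prim q).[a].
Proof.
move=> ab pq; rewrite -subr_ge0.
have [x||c cab] := @MVT_derive R (horner (prim q - prim p)) (horner (q - p)) a b.
- rewrite -{2}(deriv_prim p) -{2}(deriv_prim q) -derivB.
  exact: is_derive_poly.
- exact: ab.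
rewrite !hornerE => eqc.
have : 0 <= (q.[c] - p.[c]) * (b - a).
  by rewrite mulr_ge0 ?subr_ge0 ?pq.
by rewrite -eqc; lra.
Qed.

(** The integral over [0, 1]. Every integrand below is a polynomial, so an algebraic primitive
    suffices; linearity and monotonicity ([int01_le]) are all that the estimates use. *)
Definition int01 p : R := (prim p).[1].

Lemma int01_is_semilinear : semilinear_for *%R int01.
Proof.
split=> [a p|p q]; rewrite /int01.
  rewrite (_ : prim _ = a *: prim p) ?hornerE //.
  by apply/polyP => i; rewrite !(coef_prim, coefZ) mulrA.
rewrite -hornerD; congr horner.
by apply/polyP => i; rewrite !(coef_prim, coefD) mulrDl.
Qed.

HB.instance Definition _ :=
  GRing.isSemilinear.Build R {poly R} R *%R int01 int01_is_semilinear.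

Lemma prim_horner0 p : (prim p).[0] = 0.
Proof. by rewrite horner_coef0 coef_prim invr0 mulr0. Qed.

Lemma primXn n : prim 'X^n = n.+1%:R^-1 *: 'X^(n.+1).
Proof.
apply/polyP => -[|i]; rewrite coef_prim coefZ !coefXn /= ?invr0 ?mulr0 //.
by rewrite eqSS; case: eqP => [->|]; rewrite ?mul1r ?mul0r ?mulr1 ?mulr0.
Qed.

Lemma int01Xn n : int01 'X^n = n.+1%:R^-1.
Proof. by rewrite /int01 primXn !hornerE expr1n mulr1. Qed.

Lemma int01_le p q :
  (forall x, 0 <= x <= 1 -> p.[x] <= q.[x]) -> int01 p <= int01 q.
Proof. by move=> /(prim_le ler01); rewrite !prim_horner0 !subr0. Qed.

Lemma int01_ge0 p : (forall x, 0 <= x <= 1 -> 0 <= p.[x]) -> 0 <= int01 p.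
Proof. by move=> p0; rewrite -(raddf0 int01) int01_le // => x /p0; rewrite hornerE. Qed.

End PolynomialPrimitive.

(** * Finite pentagonal number theorem *)

Section Shanks.
Variable R : comNzRingType.
Implicit Types n j k : nat.

Definition qtail n j : {poly R} := \prod_(j.+1 <= i < n.+1) (1 - 'X^i).

Lemma qtailSn n j : (j <= n)%N -> qtail n.+1 j = qtail n j * (1 - 'X^(n.+1)).
Proof. by move=> jn; rewrite /qtail big_nat_recr. Qed.

Lemma qtailS n j : (j < n)%N -> qtail n j = (1 - 'X^(j.+1)) * qtail n j.+1.
Proof. by move=> jn; rewrite /qtail big_ltn. Qed.

Lemma qtailnn n : qtail n n = 1.
Proof. by rewrite /qtail big_geq. Qed.

Definition shanks_term n j : {poly R} :=
  (-1) ^+ j * (qtail n j * 'X^(j * n + 'C(j.+1, 2))).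

(** Let [b_j] be [(-1)^j * qtail n j * 'X^((j+1)(n+1) + 'C(j+1, 2))]. Splitting off the factor
    [1 - 'X^(n+1)] and absorbing [1 - 'X^j] into [qtail n j] turns the j-th difference into
    [b_(j-1) - b_j] (just [- b_0] when j = 0), so only [- b_J] survives. *)
Lemma shanks_telescope n J : (J <= n)%N ->
  \sum_(0 <= j < J.+1) (shanks_term n.+1 j - shanks_term n j) =
  - ((-1) ^+ J * (qtail n J * 'X^(J.+1 * n.+1 + 'C(J.+1, 2)))).
Proof.
elim: J => [|J IH] Jn.
  rewrite big_nat1 /shanks_term qtailSn // !mul0n mul1n bin_small // !addn0.
  by rewrite !expr0; ring.
rewrite big_nat_recr //= IH 1?ltnW // /shanks_term qtailSn // (qtailS Jn).
set s := (-1) ^+ J; set q := qtail n J.+1.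
rewrite !(exprS (-1) J) -/s.
rewrite (_ : J.+1 * n.+1 + 'C(J.+1, 2) = (J.+1 * n + 'C(J.+1, 2)) + J.+1)%N; last by lia.
have -> : 'C(J.+2, 2) = ('C(J.+1, 2) + J.+1)%N by rewrite binS bin1.
rewrite (_ : J.+1 * n.+1 + ('C(J.+1, 2) + J.+1) =
             (J.+1 * n + 'C(J.+1, 2)) + J.+1 + J.+1)%N; last by lia.
rewrite (_ : J.+1 * n + ('C(J.+1, 2) + J.+1) =
             (J.+1 * n + 'C(J.+1, 2)) + J.+1)%N; last by lia.
rewrite (_ : J.+2 * n.+1 + ('C(J.+1, 2) + J.+1) =
             (J.+1 * n + 'C(J.+1, 2)) + J.+1 + J.+1 + n.+1)%N; last by lia.
move: (J.+1 * n + _)%N => e; rewrite !exprD; ring.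
Qed.

(* Shanks' finite form of Euler's pentagonal number theorem: the term [j = 0]
   on the left is [\prod_(1 <= i < n.+1) (1 - 'X^i)]. *)
Lemma shanks n :
  \sum_(0 <= j < n.+1) shanks_term n j =
  1 + \sum_(1 <= k < n.+1)
        (-1) ^+ k * ('X^(k * k + 'C(k, 2)) + 'X^(k * k + 'C(k.+1, 2))).
Proof.
elim: n => [|n IH].
  by rewrite big_nat1 big_geq // /shanks_term qtailnn /= !expr0; ring.
rewrite [in RHS]big_nat_recr //= addrA -IH big_nat_recr //=.
(* From n to n + 1 the left side gains the telescoped boundary term and the new term j = n + 1;
   these are the two monomials with k = n + 1. *)
have /eqP := shanks_telescope (leqnn n).
rewrite sumrB subr_eq => /eqP ->.
rewrite /shanks_term !qtailnn exprS.
have -> : 'C(n.+2, 2) = ('C(n.+1, 2) + n.+1)%N by rewrite binS bin1.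
by rewrite mulrDr mulN1r !mul1r mulNr; ring.
Qed.

End Shanks.

(** * Partial fractions of the cosecant *)

Section HyperbolicCosecant.
Variable R : realType.
Implicit Types u v x y : R.

Definition sinh v : R := (expR v - expR (- v)) / 2.

Lemma sinh3 v : sinh (3 * v) = 4 * sinh v ^+ 3 + 3 * sinh v.
Proof.
rewrite /sinh -mulrN !expRM_natl expRN.
have := expR_gt0 v; move: (expR v) => e e0; field; exact: lt0r_neq0.
Qed.

Lemma sinh_gt0 v : 0 < v -> 0 < sinh v.
Proof. by move=> v0; rewrite divr_gt0 // subr_gt0 ltr_expR; lra. Qed.

(* Up to sign, [hcsc x y] is the imaginary part of [1 / sin (x + i y)]. *)
Definition hcsc u v : R := cos u * sinh v / (sinh v ^+ 2 + sin u ^+ 2).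

Lemma cos3 u : cos (3 * u) = 4 * cos u ^+ 3 - 3 * cos u.
Proof.
have -> : 3 * u = u *+ 2 + u by ring.
rewrite cosD cos_mulr2n sin_mulr2n.
have := sin2cos2 u; move: (sin u) (cos u) => s c sE.
by rewrite (_ : _ - _ = (2 * c ^+ 2 - 1) * c - 2 * c * s ^+ 2); [rewrite sE|]; ring.
Qed.

Lemma sin_pi6 : sin (pi / 6) = 2^-1 :> R.
Proof.
have pi0 := pi_gt0 R.
(* The angle is pi / 3, whose cosine is s = sin (pi / 6) and whose triple is pi: -1 = 4 s^3 - 3 s,
   that is (s + 1) (2 s - 1)^2 = 0. *)
have := cos3 (pi / 2 - pi / 6).
rewrite (_ : 3 * _ = pi); last by field.
rewrite cospi cosB cos_pihalf sin_pihalf mul0r add0r mul1r.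
have : 0 < sin (pi / 6 : R) by apply: sin_gt0_pihalf; apply/andP; split; lra.
move: (sin _) => s s0 /eqP; rewrite -subr_eq0.
rewrite (_ : _ - _ = - ((s + 1) * (2 * s - 1) ^+ 2)); last by ring.
by rewrite oppr_eq0 mulf_eq0 sqrf_eq0 => /orP[] /eqP; lra.
Qed.

Lemma cos_pi6 : cos (pi / 6) = Num.sqrt 3 / 2 :> R.
Proof.
have pi0 := pi_gt0 R.
have c0 : 0 <= cos (pi / 6 : R).
  by apply: cos_ge0_pihalf; apply/andP; split; lra.
have s0 : 0 <= Num.sqrt 3 / 2 :> R by rewrite divr_ge0 ?sqrtr_ge0.
apply/eqP; rewrite -(@eqrXn2 _ 2%N) //.
rewrite cos2sin2 sin_pi6 expr_div_n sqr_sqrtr //; apply/eqP; by field.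
Qed.

Lemma cos_pi3 : cos (pi / 3) = 2^-1 :> R.
Proof.
rewrite (_ : pi / 3 = (pi / 6) *+ 2 :> R); last by field.
by rewrite cos_mulr2n cos2sin2 sin_pi6; field.
Qed.

Lemma sin2_pi3 : sin (pi / 3) ^+ 2 = 3 / 4 :> R.
Proof. by rewrite sin2cos2 cos_pi3; field. Qed.

(** Imaginary part of 3 / sin (3 z) = 1 / sin z - 1 / sin (z + pi/3) - 1 / sin (z - pi/3). With a, b
    the cosines of the shifted angles and c = cos u, one has a + b = c and a b = c^2 - 3/4, so both
    sides are rational functions of c and sinh v. *)
Lemma hcsc3 u v : 0 < v ->
  hcsc (3 * u) (3 * v) =
  3^-1 * (hcsc u v - hcsc (u + pi / 3) v - hcsc (u - pi / 3) v).
Proof.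
move=> v0; rewrite /hcsc !sin2cos2 cos3 sinh3.
have S0 := sinh_gt0 v0; move: (sinh v) S0 => S S0.
have D0 w : S ^+ 2 + (1 - cos w ^+ 2) != 0.
  rewrite gt_eqF // -sin2cos2 ltr_pwDl ?sqr_ge0 // exprn_gt0 //.
have D1 := D0 u; have D2 := D0 (u + pi / 3); have D3 := D0 (u - pi / 3).
move: (cos u) (cos (u + pi / 3)) (cos (u - pi / 3)) D1 D2 D3
  (cosD u (pi / 3)) (cosB u (pi / 3)) (sin2cos2 u) => c a b D1 D2 D3.
rewrite cos_pi3; move: (sin u) (sin (pi / 3)) sin2_pi3 => s t t2 aE bE s2.
have ab : a + b = c by rewrite aE bE; field.
have abM : a * b = c ^+ 2 - 3 / 4.
  rewrite aE bE (_ : _ * _ = c ^+ 2 / 4 - s ^+ 2 * t ^+ 2); last by field.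
  by rewrite s2 t2; field.
(* The denominator at (3 u, 3 v) is 16 times the product of the three denominators on the right. *)
have DE : (4 * S ^+ 3 + 3 * S) ^+ 2 + (1 - (4 * c ^+ 3 - 3 * c) ^+ 2) =
    16 * (S ^+ 2 + (1 - c ^+ 2)) *
    ((S ^+ 2 + (1 - a ^+ 2)) * (S ^+ 2 + (1 - b ^+ 2))).
  rewrite [(_ + _) * (_ + _ )](_ : _ =
    (S ^+ 2 + 1) ^+ 2 - (S ^+ 2 + 1) * ((a + b) ^+ 2 - 2 * (a * b))
    + (a * b) ^+ 2); last by ring.
  by rewrite ab abM; field.
have NE : a * (S ^+ 2 + (1 - b ^+ 2)) + b * (S ^+ 2 + (1 - a ^+ 2)) =
    c * (S ^+ 2 + 1 - (c ^+ 2 - 3 / 4)).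
  by rewrite -abM -ab; ring.
have ME : (S ^+ 2 + (1 - a ^+ 2)) * (S ^+ 2 + (1 - b ^+ 2)) =
    (S ^+ 2 + 1) ^+ 2 - (S ^+ 2 + 1) * (c ^+ 2 - 2 * (c ^+ 2 - 3 / 4))
    + (c ^+ 2 - 3 / 4) ^+ 2.
  by rewrite -abM -ab; ring.
rewrite DE -addrA -opprD.
rewrite [a * S / _ + _](_ : _ = S * (a * (S ^+ 2 + (1 - b ^+ 2)) +
   b * (S ^+ 2 + (1 - a ^+ 2))) /
   ((S ^+ 2 + (1 - a ^+ 2)) * (S ^+ 2 + (1 - b ^+ 2)))); last first.
  by field; rewrite D2 D3.
have D23 : (S ^+ 2 + (1 - a ^+ 2)) * (S ^+ 2 + (1 - b ^+ 2)) != 0.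
  by rewrite mulf_neq0.
rewrite NE; move: D23; rewrite ME => D23.
field.
by rewrite D1 andbT; move: D23; apply: contra_neq => e; lra.
Qed.

Lemma sum_nat3 (V : nmodType) (F : nat -> V) n :
  \sum_(0 <= i < 3 * n) F i =
  \sum_(0 <= i < n) (F (3 * i)%N + F (3 * i + 1)%N + F (3 * i + 2)%N).
Proof.
elim: n => [|n IH]; first by rewrite !big_geq.
rewrite mulnS addnC !addnS addn0 !big_nat_recr //= IH !addrA.
by rewrite addn1 addn2.
Qed.

Fixpoint half3 r := if r is r'.+1 then (3 * half3 r' + 1)%N else 0%N.

Lemma half3E r : (3 ^ r = 2 * half3 r + 1)%N.
Proof. by elim: r => // r IH; rewrite expnS IH /=; lia. Qed.

(** One triplication at x / 3, then the level-r expansion of its three summands: their i-th terms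
    become those of index 3 i, 3 i + 1, 3 i + 2, the middle one coming from the unshifted summand.
    The exponent [i + half3 r] has the parity of the centred index [i - half3 r]. *)
Lemma hcsc_iter r x y : 0 < y ->
  hcsc x y = (3 ^+ r)^-1 *
    \sum_(0 <= i < 3 ^ r) (-1) ^+ (i + half3 r) *
      hcsc ((x + (i%:R - (half3 r)%:R) * pi) / 3 ^+ r) (y / 3 ^+ r).
Proof.
elim: r x y => [|r IH] x y y0.
  by rewrite expr0 invr1 big_nat1 mul1r /= addn0 expr0 subrr mul0r addr0 !mulr1 mul1r.
have y30 : 0 < y / 3 by rewrite divr_gt0.
rewrite -{1}(divfK (_ : (3 : R) != 0) x) ?pnatr_eq0 //.
rewrite -{1}(divfK (_ : (3 : R) != 0) y) ?pnatr_eq0 //.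
rewrite ![_ * 3]mulrC hcsc3 // !(IH _ _ y30) -!mulrBr mulrA -invfM -exprS.
congr (_ * _); rewrite -!sumrB expnS sum_nat3; apply: eq_bigr => i _ /=.
have yE : y / 3 / 3 ^+ r = y / 3 ^+ r.+1 by rewrite exprS invfM mulrA.
have t0 : (3 : R) ^+ r != 0 by rewrite expf_neq0 ?pnatr_eq0.
have sE e : (-1) ^+ (3 * i + e + (3 * half3 r + 1)) =
    (-1) ^+ (i + half3 r) * (-1) ^+ e.+1 :> R.
  rewrite -exprD -signr_odd -[RHS]signr_odd; congr (_ ^+ nat_of_bool _).
  by rewrite !(oddM, oddD) /=; case: (odd i); case: (odd e); case: (odd _).
have xE (e : nat) : (x + ((3 * i + e)%:R - (3 * half3 r + 1)%:R) * pi) / 3 ^+ r.+1 =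
    (x / 3 + (e%:R - 1) * (pi / 3) + (i%:R - (half3 r)%:R) * pi) / 3 ^+ r.
  by rewrite exprS !(natrM, natrD); field.
rewrite yE.
have := sE 0; have := sE 1; have := sE 2; rewrite addn0 => -> -> ->.
have := xE 0; have := xE 1; have := xE 2; rewrite addn0 => -> -> ->.
rewrite subrr mul0r addr0 sub0r mulN1r (_ : 2%:R - 1 = 1) ?mul1r; last by ring.
by ring.
Qed.

Lemma alternating_sum_sym (F : R -> R) h :
  \sum_(0 <= i < 2 * h + 1) (-1) ^+ (i + h) * F (i%:R - h%:R) =
  F 0 + \sum_(1 <= k < h.+1) (-1) ^+ k * (F k%:R + F (- k%:R)).
Proof.
elim: h => [|h IH].
  by rewrite big_nat1 big_geq // subrr addr0 mul1r.
rewrite (_ : 2 * h.+1 + 1 = (2 * h + 1).+2)%N; last by lia.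
rewrite big_nat_recr //= big_nat_recl //= [in RHS]big_nat_recr //= addrA -IH.
rewrite (eq_bigr (fun i : nat => (-1) ^+ (i + h) * F (i%:R - h%:R))); last first.
  move=> i _; rewrite addSnnS -addn2 addnA exprD sqrrN expr1n mulr1.
  by congr (_ * F _); rewrite -!natr1; ring.
rewrite sub0r (_ : (2 * h + 1).+1%:R - h.+1%:R = h.+1%:R); last first.
  by rewrite -!natr1 natrD natrM; ring.
rewrite (_ : (2 * h + 1).+1 + h.+1 = h.+1 + 2 * h.+1)%N; last by lia.
rewrite (exprD _ h.+1) exprM sqrrN !expr1n mulr1 add0n.
by ring.
Qed.

(** * Elementary bounds for sin, cos, sinh and cosh *)

Lemma sin_ge_mul_cos u : 0 <= u <= pi -> u * cos u <= sin u.
Proof.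
move=> /andP[u0 upi]; rewrite -subr_ge0.
have [x||c /andP[c0 cu]] := @MVT_derive R (fun x => sin x - x * cos x)
  (fun x => x * sin x) 0 u.
- by apply: is_derive_eq; rewrite /GRing.scale /=; ring.
- exact: u0.
rewrite sin0 !mul0r !subr0 => ->; rewrite !mulr_ge0 // sin_ge0_pi //.
by rewrite c0 (le_trans cu).
Qed.

Definition cosh v : R := (expR v + expR (- v)) / 2.

Lemma cosh2 v : cosh v ^+ 2 = 1 + sinh v ^+ 2.
Proof.
by rewrite /cosh /sinh expRN; have := expR_gt0 v; move: (expR v) => e e0;
  field; exact: lt0r_neq0.
Qed.

Lemma cosh_half v : cosh v = 1 + 2 * sinh (v / 2) ^+ 2.
Proof.
rewrite -{1}(divfK (_ : (2 : R) != 0) v) ?pnatr_eq0 // mulrC.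
rewrite /cosh /sinh -mulrN !expRM_natl !expRN.
by have := expR_gt0 (v / 2); move: (expR (v / 2)) => e e0;
  field; exact: lt0r_neq0.
Qed.

Lemma cosh_ge1 v : 1 <= cosh v.
Proof. by rewrite cosh_half lerDl mulr_ge0 ?sqr_ge0. Qed.

Lemma cosh_le_expR v : 0 <= v -> cosh v <= expR v.
Proof. by move=> v0; have := ler_expR (- v) v; rewrite /cosh; lra. Qed.

Lemma is_derive_sinh v : is_derive v 1 sinh (cosh v).
Proof. by rewrite /sinh /cosh; apply: is_derive_eq; rewrite /GRing.scale /=; field. Qed.

Lemma is_derive_cosh v : is_derive v 1 cosh (sinh v).
Proof. by rewrite /sinh /cosh; apply: is_derive_eq; rewrite /GRing.scale /=; field. Qed.

Lemma sinh_bounds v : 0 <= v -> v <= sinh v <= v * cosh v.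
Proof.
move=> v0; rewrite -subr_ge0 -(subr_ge0 _ (v * _)).
have sinh0 : sinh 0 = 0 by rewrite /sinh oppr0 subrr mul0r.
have sinh_ge0 c : 0 <= c -> 0 <= sinh c.
  by rewrite le_eqVlt => /orP[/eqP <-|/sinh_gt0/ltW//]; rewrite sinh0.
have d1 x : is_derive x 1 (fun x => sinh x - x) (cosh x - 1).
  by have := is_derive_sinh x => ?; apply: is_derive_eq.
have d2 x : is_derive x 1 (fun x => x * cosh x - sinh x) (x * sinh x).
  have := is_derive_sinh x => ?; have := is_derive_cosh x => ?.
  by apply: is_derive_eq; rewrite /GRing.scale /=; ring.
apply/andP; split.
  have [c _] := MVT_derive d1 v0.
  rewrite sinh0 subrr subr0 => ->.
  by rewrite mulr_ge0 ?subr0 // subr_ge0 cosh_ge1.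
have [c /andP[c0 _]] := MVT_derive d2 v0.
by rewrite sinh0 mul0r !subr0 => ->; rewrite mulr_ge0 // mulr_ge0 // sinh_ge0.
Qed.

Lemma sin2_norm u : sin `|u| ^+ 2 = sin u ^+ 2.
Proof. by case: (ler0P u); rewrite // sinN sqrrN. Qed.

Lemma sin2_le u : sin u ^+ 2 <= u ^+ 2.
Proof.
have [|c _] := @MVT_derive R sin cos 0 `|u| _; first exact: normr_ge0.
rewrite sin0 !subr0 -(sin2_norm u) => ->.
rewrite exprMn real_normK ?num_real // ler_piMl ?sqr_ge0 //.
Qed.

Lemma cos_ge u : 1 - u ^+ 2 / 2 <= cos u.
Proof.
rewrite -{2}(divfK (_ : (2 : R) != 0) u) ?pnatr_eq0 // mulr_natr cos_mulr2n.
by rewrite cos2sin2; have := sin2_le (u / 2); rewrite expr_div_n; lra.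
Qed.

(** Square [u cos u <= sin u] and use cos^2 = 1 - sin^2 >= 1 - u^2. *)
Lemma sin2_ge u : `|u| <= pi / 2 -> u ^+ 2 - u ^+ 4 <= sin u ^+ 2.
Proof.
move=> upi; have pi0 := pi_gt0 R; have h0 := normr_ge0 u; rewrite -sin2_norm.
have c0 : 0 <= cos `|u| by apply: cos_ge0_pihalf; apply/andP; split; lra.
have sc : `|u| * cos `|u| <= sin `|u|.
  by apply: sin_ge_mul_cos; rewrite normr_ge0 /=; lra.
apply: le_trans (_ : (`|u| * cos `|u|) ^+ 2 <= _).
  rewrite exprMn real_normK ?num_real // cos2sin2 sin2_norm mulrBr mulr1.
  by rewrite lerB // (exprD u 2 2) ler_wpM2l ?sqr_ge0 ?sin2_le.
by rewrite lerXn2r ?nnegrE ?mulr_ge0 // (le_trans _ sc) ?mulr_ge0.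
Qed.

(** Complements [sin2_ge], which is void for |u| >= 1. For u >= 0, sin u = 2 sin (u/2) cos (u/2) >=
    u cos (u/2)^2 >= u / 2, because 2 cos (u/2)^2 = 1 + cos u >= 1. *)
Lemma sin2_ge_quarter u : `|u| <= pi / 2 -> u ^+ 2 / 4 <= sin u ^+ 2.
Proof.
move=> upi; have pi0 := pi_gt0 R; rewrite -sin2_norm.
have h0 := normr_ge0 u.
have c0 : 0 <= cos `|u| by apply: cos_ge0_pihalf; apply/andP; split; lra.
have hc0 : 0 <= cos (`|u| / 2) by apply: cos_ge0_pihalf; apply/andP; split; lra.
have sc : `|u| / 2 * cos (`|u| / 2) <= sin (`|u| / 2).
  by apply: sin_ge_mul_cos; apply/andP; split; lra.
have uE : `|u| = (`|u| / 2) *+ 2 by rewrite -mulr_natr; field.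
have su : `|u| / 2 <= sin `|u|.
  rewrite [in sin _]uE sin_mulr2n.
  apply: le_trans (_ : (cos (`|u| / 2) * (`|u| / 2 * cos (`|u| / 2))) *+ 2 <= _).
    have -> : (cos (`|u| / 2) * (`|u| / 2 * cos (`|u| / 2))) *+ 2 =
        `|u| * cos (`|u| / 2) ^+ 2 by rewrite -[LHS]mulr_natr; field.
    have := cos_mulr2n (`|u| / 2); rewrite -uE => cE.
    by rewrite ler_wpM2l //; move: c0; rewrite cE; lra.
  by rewrite lerMn2r /= ler_wpM2l.
rewrite -[u ^+ 2](real_normK (num_real u)) (_ : _ / 4 = (`|u| / 2) ^+ 2).
  by rewrite lerXn2r ?nnegrE ?(le_trans _ su) ?divr_ge0.
by rewrite expr_div_n; field.
Qed.

(** Over a common denominator, the numerator is O(v (u^2 + v^2)^2) and the denominator is at least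
    (u^2 + v^2)^2 / 4. An error linear in v is what makes the sum of the 3^r rescaled errors
    vanish. *)
Lemma hcsc_approx : exists C : R, forall u v, `|u| <= pi / 2 -> 0 < v <= 1 ->
  `|hcsc u v - v / (u ^+ 2 + v ^+ 2)| <= C * v.
Proof.
pose Q : R := expR 1 ^+ 2.
have Q1 : 1 <= Q by rewrite expr_ge1 // ltW // expR_gt1.
(* [Q] bounds cosh^2 on [0, 1]; [3 * Q + 2] bounds the numerator ([N1], [N2]), and the 4 comes from
   [sin2_ge_quarter]. *)
exists (4 * (3 * Q + 2)) => u v upi /andP[v0 v1].
have ch w : 0 <= w <= 1 -> cosh w ^+ 2 <= Q.
  move=> /andP[w0 w1]; rewrite lerXn2r ?nnegrE ?expR_ge0 //.
    by rewrite (le_trans ler01) ?cosh_ge1.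
  by rewrite (le_trans (cosh_le_expR w0)) // ler_expR.
clearbody Q.
have sh2 w : 0 <= w <= 1 -> w ^+ 2 <= sinh w ^+ 2 <= w ^+ 2 * Q.
  move=> w01; have /andP[w0 _] := w01; have /andP[s1 s2] := sinh_bounds w0.
  have s0 : 0 <= sinh w by exact: le_trans s1.
  apply/andP; split; first by rewrite lerXn2r ?nnegrE.
  apply: le_trans (_ : (w * cosh w) ^+ 2 <= _).
    by rewrite lerXn2r ?nnegrE // (le_trans s0).
  by rewrite exprMn ler_wpM2l ?sqr_ge0 // ch.
have v01 : 0 <= v <= 1 by rewrite ltW.
have /andP[s1 s2] := sinh_bounds (ltW v0).
have S0 := le_trans (ltW v0) s1.
have S2l : v ^+ 2 <= sinh v ^+ 2 by have /andP[] := sh2 v v01.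
have S2u : sinh v ^+ 2 <= v ^+ 2 + Q * v ^+ 4.
  have /andP[_ h] := sh2 v v01.
  apply: le_trans (_ : v ^+ 2 * cosh v ^+ 2 <= _).
    by rewrite -exprMn lerXn2r ?nnegrE // ?(le_trans S0 s2).
  rewrite cosh2 mulrDr mulr1 lerD2l (_ : Q * v ^+ 4 = v ^+ 2 * (v ^+ 2 * Q)); last by ring.
  by rewrite ler_wpM2l ?sqr_ge0.
have Su : sinh v <= v + Q * v ^+ 3.
  apply: le_trans s2 _; rewrite cosh_half.
  have /andP[_] : (v / 2) ^+ 2 <= sinh (v / 2) ^+ 2 <= (v / 2) ^+ 2 * Q.
    by apply: sh2; apply/andP; split; lra.
  rewrite (expr_div_n v) => h.
  rewrite mulrDr mulr1 lerD2l (_ : Q * v ^+ 3 = v * (Q * v ^+ 2)); last by ring.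
  rewrite ler_wpM2l ?(ltW v0) //.
  have : 0 <= v ^+ 2 * Q by rewrite mulr_ge0 ?sqr_ge0 // (le_trans ler01 Q1).
  by lra.
have c1 := cos_le1 u; have c2 := cos_ge u.
have t1 := sin2_le u; have t2 := sin2_ge upi; have t3 := sin2_ge_quarter upi.
rewrite /hcsc; move: (sinh v) (sin u ^+ 2) (cos u) s1 s2 S2l S2u Su c1 c2 t1 t2 t3
  => S s c s1 _ S2l S2u Su c1 c2 t1 t2 t3 {sh2 ch}.
have u0 := sqr_ge0 u; have vv : 0 < v ^+ 2 by rewrite exprn_gt0.
have r0 : 0 < u ^+ 2 + v ^+ 2 by lra.
have D0 : 0 < S ^+ 2 + s by lra.
rewrite (_ : _ - _ = (c * S * (u ^+ 2 + v ^+ 2) - v * (S ^+ 2 + s)) /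
   ((S ^+ 2 + s) * (u ^+ 2 + v ^+ 2))); last first.
  by field; rewrite !lt0r_neq0.
have Q0 : 0 <= Q by lra.
have SQ : S <= v * (1 + Q).
  apply: le_trans Su _; rewrite mulrDr mulr1 lerD2l mulrC ler_wpM2r //.
  by rewrite exprS ler_piMr ?(ltW v0) // exprn_ile1 // ltW.
have v4 : v ^+ 4 = v ^+ 2 * v ^+ 2 by rewrite -exprD.
have u4 : u ^+ 4 = u ^+ 2 * u ^+ 2 by rewrite -exprD.
have v3 : v ^+ 3 = v * v ^+ 2 by rewrite -exprS.
rewrite v3 v4 u4 in S2u Su t2.
move: (u ^+ 2) (v ^+ 2) u0 vv r0 S2l S2u Su c2 t1 t2 t3 {v3 v4 u4 upi}
  => a b a0 b0 r0 S2l S2u Su c2 t1 t2 t3.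
have N1 : c * S * (a + b) - v * (S ^+ 2 + s) <= (3 * Q + 2) * v * (a + b) ^+ 2.
  have h1 : c * S * (a + b) <= (v + Q * (v * b)) * (a + b).
    by rewrite ler_wpM2r ?(ltW r0) // (le_trans _ Su) // ler_piMl // (le_trans _ s1) // ltW.
  have h2 : v * (b + (a - a * a)) <= v * (S ^+ 2 + s).
    by rewrite ler_wpM2l ?(ltW v0) // lerD.
  have h3 : 0 <= v * (a * b) by rewrite !mulr_ge0 // ltW.
  have h4 : 0 <= v * (a * a) by rewrite !mulr_ge0 // ltW.
  have h5 : 0 <= v * (b * b) by rewrite !mulr_ge0 // ltW.
  have h6 := mulr_ge0 Q0 h3; have h7 := mulr_ge0 Q0 h4; have h8 := mulr_ge0 Q0 h5.
  by lra.
have N2 : - ((3 * Q + 2) * v * (a + b) ^+ 2) <= c * S * (a + b) - v * (S ^+ 2 + s).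
  have h1 : (v - v * (1 + Q) * (a / 2)) * (a + b) <= c * S * (a + b).
    rewrite ler_wpM2r ?(ltW r0) //.
    have : (1 - c) * S <= a / 2 * (v * (1 + Q)) by rewrite ler_pM //; lra.
    by lra.
  have h2 : v * (S ^+ 2 + s) <= v * ((b + Q * (b * b)) + a).
    by rewrite ler_wpM2l ?(ltW v0) // lerD.
  have h3 : 0 <= v * (a * b) by rewrite !mulr_ge0 // ltW.
  have h4 : 0 <= v * (a * a) by rewrite !mulr_ge0 // ltW.
  have h5 : 0 <= v * (b * b) by rewrite !mulr_ge0 // ltW.
  have h6 := mulr_ge0 Q0 h3; have h7 := mulr_ge0 Q0 h4; have h8 := mulr_ge0 Q0 h5.
  by lra.
have D1 := mulr_gt0 D0 r0.
rewrite normrM normfV [X in _ / X]gtr0_norm // ler_pdivrMr //.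
apply: le_trans (_ : (3 * Q + 2) * v * (a + b) ^+ 2 <= _).
  by rewrite ler_norml N2 N1.
rewrite expr2 [leRHS](_ : _ = (3 * Q + 2) * v * ((4 * (S ^+ 2 + s)) * (a + b))); last by ring.
rewrite ler_wpM2l //; first by rewrite mulr_ge0 ?(ltW v0) //; lra.
by rewrite ler_wpM2r ?(ltW r0) //; lra.
Qed.

(** The truncated sum is the exact expansion [hcsc_iter] with each [hcsc] replaced by its
    Lorentzian. Each of the 3^r terms has weight 3^-r and error at most C y / 3^r, so the total
    error is at most C y / 3^r. *)
Lemma lorentzian_sum_cvg x y : `|x| <= pi / 2 -> 0 < y ->
  (fun r => y / (x ^+ 2 + y ^+ 2) + \sum_(1 <= k < (half3 r).+1) (-1) ^+ k *
     (y / ((x + k%:R * pi) ^+ 2 + y ^+ 2) + y / ((x - k%:R * pi) ^+ 2 + y ^+ 2)))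
  @ \oo --> hcsc x y.
Proof.
move=> xpi y0; have [C hC] := hcsc_approx; have pi0 := pi_gt0 R.
pose F (t : R) := y / ((x + t * pi) ^+ 2 + y ^+ 2).
have C0 : 0 <= C.
  have := hC 0 1; rewrite normr0 divr_ge0 ?(ltW pi0) // ltr01 lexx mulr1.
  by move=> /(_ isT isT); exact: le_trans.
have t0 r : 0 < (3 : R) ^+ r by rewrite exprn_gt0.
have cvg0 : (fun r => C * y * (3^-1) ^+ r) @ \oo --> (0 : R).
  rewrite -[X in _ --> X](mulr0 (C * y)); apply: cvgMr.
  apply: cvg_expr; rewrite ger0_norm ?invr_ge0 // invf_lt1 //; lra.
apply/cvgrPdist_le => e e0.
move/cvgrPdist_le: cvg0 => /(_ e e0) cvg0.
(* Needed for the condition y / 3^r <= 1 of [hcsc_approx]. *)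
have big3 : \forall r \near \oo, y <= (3 : R) ^+ r.
  have := cvg_expr (_ : `|3^-1 : R| < 1).
  rewrite ger0_norm ?invr_ge0 // => /(_ _)/cvgrPdist_le.
  rewrite invf_lt1 // => /(_ _ y^-1).
  have h : (1 < 3 :> R) by lra.
  move=> /(_ h); rewrite invr_gt0 => /(_ y0); apply: filterS => r.
  rewrite sub0r normrN ger0_norm ?exprn_ge0 ?invr_ge0 //.
  by rewrite exprVn lef_pV2 ?posrE.
near=> r.
have yr : y <= (3 : R) ^+ r by near: r.
have cr : `|0 - C * y * 3^-1 ^+ r| <= e by near: r.
have {}cr : C * y * 3^-1 ^+ r <= e.
  by apply: le_trans cr; rewrite sub0r normrN ler_norm.
apply: le_trans cr.
rewrite [X in hcsc _ _ - X](_ : _ = \sum_(0 <= i < 3 ^ r) (-1) ^+ (i + half3 r) *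
    F (i%:R - (half3 r)%:R)); last first.
  rewrite half3E alternating_sum_sym /F mul0r addr0; congr (_ + _).
  by apply: eq_bigr => k _; rewrite mulNr.
rewrite (hcsc_iter r) // mulr_sumr -sumrB.
apply: le_trans (ler_norm_sum _ _ _) _.
apply: le_trans (_ : \sum_(0 <= i < 3 ^ r) (3 ^+ r)^-1 * (C * (y / 3 ^+ r)) <= _).
  apply: ler_sum_nat => i /andP[_ ir].
  set U := x + (i%:R - _) * pi.
  (* The Lorentzian is homogeneous of degree -1, so rescaling by 3^r produces the weight of
     [hcsc_iter]. *)
  have -> : F (i%:R - (half3 r)%:R) = (3 ^+ r)^-1 *
     ((y / 3 ^+ r) / ((U / 3 ^+ r) ^+ 2 + (y / 3 ^+ r) ^+ 2)).
    have UU : U ^+ 2 + y ^+ 2 != 0.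
      by rewrite gt_eqF // ltr_wpDl ?sqr_ge0 ?exprn_gt0.
    rewrite /F -/U; move: (3 ^+ r) (t0 r) => n n0; field.
    by rewrite UU lt0r_neq0.
  rewrite mulrCA -mulrBr normrM normr_sign mul1r -mulrBr normrM.
  rewrite ger0_norm ?invr_ge0 ?(ltW (t0 r)) // ler_wpM2l ?invr_ge0 ?(ltW (t0 r)) //.
  apply: hC; last by rewrite divr_gt0 // ler_pdivrMr // mul1r.
  rewrite normrM normfV (gtr0_norm (t0 r)) ler_pdivrMr //.
  apply: le_trans (ler_normD _ _) _; rewrite normrM (gtr0_norm pi0).
  (* Hence |U| <= pi / 2 + [half3 r] * pi = 3^r * pi / 2, and U / 3^r stays in the range of
     [hcsc_approx]. *)
  have iB : `|i%:R - (half3 r)%:R| <= (half3 r)%:R :> R.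
    have ir2 : (i <= 2 * half3 r)%N by rewrite half3E in ir; lia.
    have : i%:R <= 2 * (half3 r)%:R :> R by rewrite -natrM ler_nat.
    have := ler0n R i; have := ler0n R (half3 r).
    by rewrite ler_norml => *; apply/andP; split; lra.
  have : `|i%:R - (half3 r)%:R| * pi <= (half3 r)%:R * pi :> R by rewrite ler_wpM2r ?(ltW pi0).
  have -> : 3 ^+ r = 2 * (half3 r)%:R + 1 :> R by rewrite -natrX half3E natrD natrM.
  by lra.
rewrite sumr_const_nat subn0 -[leLHS]mulr_natl natrX exprVn.
rewrite mulrA mulfV ?lt0r_neq0 // mul1r mulrA.
exact: lexx.
Unshelve. all: by end_near. Qed.

End HyperbolicCosecant.

(** * Asymptotics of the pentagonal sums *)

Section Pentagonal.
Variable R : realType.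
Implicit Types n j k s N : nat.

Lemma qtail_itv n j (x : R) : 0 <= x <= 1 -> 0 <= (qtail R n j).[x] <= 1.
Proof.
move=> /andP[x0 x1]; rewrite /qtail; elim/big_ind: _ => [|p q|i _].
- by rewrite hornerE ler01 lexx.
- move=> /andP[p0 p1] /andP[q0 q1]; rewrite hornerM mulr_ge0 //=.
  by rewrite mulr_ile1.
- by rewrite !hornerE subr_ge0 exprn_ile1 //= gerBl exprn_ge0.
Qed.

(** The Laplace transform at s of the maximum of X_1, ..., X_N, after an integration by parts and
    the substitution t = exp (- x); this is [g s] of the overview. *)
Definition laplaceM N s : R := s%:R * int01 ('X^(s.-1) * qtail R N 0).

(** A crude bound on the harmonic sum, enough because it gets divided by N in
    [laplaceM_pentagonal]. *)
Lemma sum_invn_le N : \sum_(1 <= j < N.+1) (j%:R)^-1 <= 2 * Num.sqrt N%:R :> R.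
Proof.
elim: N => [|N IH]; first by rewrite big_geq // sqrtr0 mulr0.
rewrite big_nat_recr //=; apply: le_trans (lerD IH (lexx _)) _.
rewrite addrC -lerBrDr -mulrBr.
set a := Num.sqrt _; set b := Num.sqrt _.
have a1 : 1 <= a by rewrite -[leLHS]sqrtr1 ler_wsqrtr // ler1n.
have a2 : a ^+ 2 = N.+1%:R by rewrite sqr_sqrtr.
have b2 : b ^+ 2 = N%:R by rewrite sqr_sqrtr.
have ba : b <= a by rewrite ler_wsqrtr // ler_nat.
have b0 : 0 <= b by exact: sqrtr_ge0.
have ab : (a - b) * (a + b) = 1 by rewrite -subr_sqr a2 b2 -natr1; ring.
rewrite -[leLHS]mul1r -a2 ler_pdivrMr ?exprn_gt0 ?(lt_le_trans ltr01 a1) //.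
have aa : a <= a ^+ 2 by rewrite expr2 ler_peMl // (le_trans ler01 a1).
have : (a - b) * (a + b) <= (a - b) * (2 * a ^+ 2).
  by rewrite ler_wpM2l ?subr_ge0 //; lra.
by rewrite ab; lra.
Qed.

Lemma bin2_half k : ('C(k, 2))%:R = (k%:R ^+ 2 - k%:R) / 2 :> R.
Proof.
elim: k => [|k IH]; first by rewrite expr0n /= subrr mul0r.
by rewrite binS bin1 natrD IH -natr1; field.
Qed.

Definition pentagonal_sum N s : R :=
  1 + \sum_(1 <= k < N.+1) (-1) ^+ k *
    (s%:R / (s + k * k + 'C(k.+1, 2))%:R + s%:R / (s + k * k + 'C(k, 2))%:R).

(** By [shanks], the difference consists of the terms j >= 1 of the Shanks sum. As [qtail] lies in
    [0, 1] on [0, 1], the j-th one integrates to at most 1 / (j N) in absolute value. *)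
Lemma laplaceM_pentagonal N s : (0 < N)%N -> (0 < s)%N ->
  `|laplaceM N s - pentagonal_sum N s| <= 2 * s%:R / Num.sqrt N%:R.
Proof.
move=> N0 s0.
have IX e : int01 ('X^(s.-1) * 'X^e) = (s + e)%:R^-1 :> R.
  by rewrite -exprD int01Xn -addSn prednK.
have I1 : int01 'X^(s.-1) = s%:R^-1 :> R by rewrite int01Xn prednK.
have qE : qtail R N 0 = 1 + \sum_(1 <= k < N.+1)
    (-1) ^+ k * ('X^(k * k + 'C(k, 2)) + 'X^(k * k + 'C(k.+1, 2))) -
    \sum_(1 <= j < N.+1) shanks_term R N j.
  apply/eqP; rewrite -shanks eq_sym subr_eq big_ltn // /shanks_term.
  by rewrite expr0 mul1r mul0n bin_small // expr0 mulr1.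
have s1 : (s%:R : R) != 0 by rewrite pnatr_eq0 -lt0n.
have -> : laplaceM N s - pentagonal_sum N s =
    - (s%:R * \sum_(1 <= j < N.+1) int01 ('X^(s.-1) * shanks_term R N j)).
  rewrite /laplaceM qE mulrBr mulrDr mulr1 raddfB /= raddfD /= I1 !mulr_sumr.
  rewrite !(raddf_sum (@int01 R)) /= mulrBr mulrDr mulfV // !mulr_sumr /pentagonal_sum.
  rewrite [X in 1 + X - _ - _](_ : _ = \sum_(1 <= k < N.+1) (-1) ^+ k *
    (s%:R / (s + k * k + 'C(k.+1, 2))%:R + s%:R / (s + k * k + 'C(k, 2))%:R)).
    by rewrite -!mulr_sumr; ring.
  apply: eq_bigr => k _; rewrite mulrCA raddfMsign /= mulrDr raddfD /= !IX.
  by rewrite !addnA; ring.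
rewrite normrN normrM ger0_norm // -[leRHS]mulrA (mulrC 2) -mulrA ler_wpM2l //.
apply: le_trans (ler_norm_sum _ _ _) _.
apply: le_trans (_ : \sum_(1 <= j < N.+1) N%:R^-1 * j%:R^-1 <= _).
  apply: ler_sum_nat => j /andP[j1 jN]; rewrite /shanks_term mulrCA raddfMsign /=.
  rewrite normrM normr_sign mul1r ger0_norm; last first.
    apply: int01_ge0 => x x01; have /andP[q0 _] := qtail_itv N j x01.
    by case/andP: x01 => x0 _; rewrite !hornerE !mulr_ge0 ?exprn_ge0.
  apply: le_trans (_ : int01 ('X^(s.-1) * 'X^(j * N + 'C(j.+1, 2))) <= _).
    apply: int01_le => x x01; have /andP[_ q1] := qtail_itv N j x01.
    case/andP: x01 => x0 _; rewrite !hornerM !hornerXn ler_wpM2l ?exprn_ge0 //.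
    by rewrite ler_piMl ?exprn_ge0.
  rewrite IX -invfM -natrM lef_pV2 ?posrE ?ltr0n ?muln_gt0 ?addn_gt0 ?N0 ?s0 //.
  by rewrite ler_nat mulnC; lia.
rewrite -mulr_sumr; apply: le_trans (ler_wpM2l _ (sum_invn_le N)) _.
  by rewrite invr_ge0.
rewrite -{1}(sqr_sqrtr (ler0n R N)) le_eqVlt; apply/orP; left; apply/eqP.
by field; rewrite gt_eqF // sqrtr_gt0 ltr0n.
Qed.

(** Chosen to complete the square: (pi/6 + t pi)^2 + [freq s]^2 = (2/3) pi^2 (s + (3 t^2 + t) /
    2). *)
Definition freq s : R := pi * Num.sqrt (24 * s%:R - 1) / 6.

Lemma freq2 s : (0 < s)%N -> freq s ^+ 2 = pi ^+ 2 * (24 * s%:R - 1) / 36.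
Proof.
move=> s0; have : 1 <= s%:R :> R by rewrite ler1n.
by move=> s1; rewrite /freq !exprMn sqr_sqrtr ?exprVn; [field|lra].
Qed.

Lemma freq_gt0 s : (0 < s)%N -> 0 < freq s.
Proof.
move=> s0; have : 1 <= s%:R :> R by rewrite ler1n.
by move=> s1; rewrite !divr_gt0 ?mulr_gt0 ?pi_gt0 ?sqrtr_gt0 //; lra.
Qed.

Lemma pentagonal_sum_lorentzian N s : (0 < s)%N ->
  pentagonal_sum N s = 2 * s%:R * pi ^+ 2 / (3 * freq s) *
   (freq s / ((pi / 6) ^+ 2 + freq s ^+ 2) + \sum_(1 <= k < N.+1) (-1) ^+ k *
     (freq s / ((pi / 6 + k%:R * pi) ^+ 2 + freq s ^+ 2) +
      freq s / ((pi / 6 - k%:R * pi) ^+ 2 + freq s ^+ 2))).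
Proof.
move=> s0; have s1 : 1 <= s%:R :> R by rewrite ler1n.
have y0 := lt0r_neq0 (freq_gt0 s0); have p0 := lt0r_neq0 (pi_gt0 R).
(* Used at t = 0, k and -k; the last two give the pentagonal exponents k (3 k + 1) / 2 and k (3 k -
   1) / 2. *)
have e (t : R) : 0 < s%:R + (3 * t ^+ 2 + t) / 2 ->
  2 * s%:R * pi ^+ 2 / (3 * freq s) *
    (freq s / ((pi / 6 + t * pi) ^+ 2 + freq s ^+ 2)) =
  s%:R / (s%:R + (3 * t ^+ 2 + t) / 2).
  move=> h; rewrite [X in freq s / X](_ : _ =
    2 / 3 * pi ^+ 2 * (s%:R + (3 * t ^+ 2 + t) / 2)); last first.
    by rewrite freq2 //; field.
  move: h => /lt0r_neq0; move: (freq s) (pi : R) y0 p0 => y p y0 p0 h.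
  field; rewrite p0 y0 !andbT; apply: contra_neq h => h; lra.
rewrite mulrDr /pentagonal_sum; congr (_ + _).
  have := e 0; rewrite mul0r addr0 expr0n /= mulr0 !(addr0, mul0r) => ->; last by lra.
  by rewrite mulfV //; lra.
rewrite mulr_sumr; apply: eq_bigr => k _; rewrite [RHS]mulrCA; congr (_ * _).
rewrite [RHS]mulrDr.
have k0 : 0 <= k%:R :> R by [].
have kk : k%:R <= k%:R ^+ 2 :> R.
  by rewrite -natrX ler_nat; case: (k) => // n; rewrite leq_pmulr.
rewrite e; last by lra.
rewrite -mulNr e; last by rewrite sqrrN; lra.
have d c : (s + k * k + c)%:R = s%:R + k%:R * k%:R + c%:R :> R.
  by rewrite !natrD natrM.
rewrite !d !bin2_half -(natr1 k) sqrrN.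
by congr (_ / _ + _ / _); field.
Qed.

Definition laplaceM_lim s : R :=
  2 * s%:R * pi ^+ 2 / (3 * freq s) * hcsc (pi / 6) (freq s).

Lemma half3_ge r : (r <= half3 r)%N.
Proof. by elim: r => // r IH /=; lia. Qed.

Lemma half3_cvg : half3 r @[r --> \oo] --> \oo.
Proof.
apply/cvgnyPge => A; near=> r; apply: leq_trans (half3_ge r).
by near: r; exists A.
Unshelve. all: by end_near. Qed.

Lemma invsqrt_cvg0 : (Num.sqrt n%:R)^-1 @[n --> \oo] --> (0 : R).
Proof.
apply/cvgrPdist_le => e e0; near=> n.
have e20 : 0 < (e ^+ 2)^-1 by rewrite invr_gt0 exprn_gt0.
have n1 : (e ^+ 2)^-1 <= n%:R.
  by near: n; apply: nbhs_infty_ger.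
have n0 : 0 < n%:R :> R by exact: lt_le_trans n1.
rewrite sub0r normrN ger0_norm ?invr_ge0 ?sqrtr_ge0 //.
rewrite -[leRHS]invrK lef_pV2 ?posrE ?sqrtr_gt0 ?invr_gt0 //.
rewrite -[leLHS]gtr0_norm ?invr_gt0 // -sqrtr_sqr exprVn.
by rewrite ler_wsqrtr.
Unshelve. all: by end_near. Qed.

Lemma laplaceM_cvg s : (0 < s)%N ->
  laplaceM (half3 r) s @[r --> \oo] --> laplaceM_lim s.
Proof.
move=> s0; have pi0 := pi_gt0 R; have y0 := freq_gt0 s0.
have p1 : pentagonal_sum (half3 r) s @[r --> \oo] --> laplaceM_lim s.
  under eq_cvg do rewrite pentagonal_sum_lorentzian //.
  apply: cvgMr; apply: lorentzian_sum_cvg => //.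
  by rewrite ger0_norm; lra.
have p2 : laplaceM (half3 r) s - pentagonal_sum (half3 r) s @[r --> \oo] --> (0 : R).
  apply: norm_cvg0.
  apply: (@squeeze_cvgr _ _ _ _ (cst 0) (fun r => 2 * s%:R * (Num.sqrt (half3 r)%:R)^-1)).
  - exists 1%N => // r /= r1; rewrite normr_ge0 /=.
    by apply: laplaceM_pentagonal => //; exact: leq_trans (half3_ge r).
  - exact: cvg_cst.
  - rewrite -(mulr0 (2 * s%:R)); apply: cvgMr.
    apply: (cvg_comp half3 (fun n => (Num.sqrt n%:R)^-1) half3_cvg).
    exact: invsqrt_cvg0.
rewrite -[X in _ --> X]add0r (_ : (fun r => _) = fun r =>
  (laplaceM (half3 r) s - pentagonal_sum (half3 r) s) + pentagonal_sum (half3 r) s).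
  exact: cvgD.
by apply/funext => r; rewrite subrK.
Qed.

(** * Comparison of the closed form with the claimed equivalent *)

Definition target s : R :=
  pi * Num.sqrt (2 * s%:R) * expR (- (pi * Num.sqrt (2 / 3)) * Num.sqrt s%:R).

Lemma target_gt0 s : (0 < s)%N -> 0 < target s.
Proof.
by move=> s0; rewrite !mulr_gt0 ?pi_gt0 ?expR_gt0 // sqrtr_gt0 mulr_gt0 ?ltr0n.
Qed.

Definition decay s : R := pi * Num.sqrt (2 / 3) * Num.sqrt s%:R.

(** Three factors tending to 1. The last one collects the lower exponentials of [hcsc (pi / 6) y],
    which equals sqrt 3 * exp (- y) (1 - q) / (1 - q + q^2) with q = exp (- 2 y). *)
Definition ratio s : R :=
  let q := expR (- freq s) ^+ 2 in
  decay s / freq s * expR (decay s - freq s) * ((1 - q) / (1 - q + q ^+ 2)).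

Lemma laplaceM_limE s : (0 < s)%N -> laplaceM_lim s = target s * ratio s.
Proof.
move=> s0; have y0 := freq_gt0 s0; have s1 : 0 < s%:R :> R by rewrite ltr0n.
have K : Num.sqrt (2 * s%:R) * Num.sqrt (2 / 3) * Num.sqrt s%:R =
    2 / 3 * s%:R * Num.sqrt 3 :> R.
  rewrite -!sqrtrM ?mulr_ge0 ?divr_ge0 //.
  have -> : 2 * s%:R * (2 / 3) * s%:R = (2 / 3 * s%:R) ^+ 2 * 3 :> R by field.
  by rewrite sqrtrM ?sqr_ge0 // sqrtr_sqr ger0_norm // mulr_ge0 ?divr_ge0.
have X : expR (- decay s) * expR (decay s - freq s) = (expR (freq s))^-1.
  by rewrite -expRD -expRN; congr expR; ring.
rewrite /laplaceM_lim /target /hcsc sin_pi6 cos_pi6 mulNr -/(decay s) /ratio.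
rewrite [RHS](_ : _ = (pi * (Num.sqrt (2 * s%:R) * decay s)) / freq s *
  (expR (- decay s) * expR (decay s - freq s)) *
  ((1 - expR (- freq s) ^+ 2) /
   (1 - expR (- freq s) ^+ 2 + (expR (- freq s) ^+ 2) ^+ 2))); last by ring.
have -> : Num.sqrt (2 * s%:R) * decay s = pi * (2 / 3 * s%:R * Num.sqrt 3).
  by rewrite -K /decay; ring.
rewrite X.
rewrite /sinh expRN; have E1 : 1 < expR (freq s) by rewrite expR_gt1.
move: (expR _) E1 => E E1; move: (freq s) y0 (pi : R) (Num.sqrt 3) => y y0 p t.
have E0 : 0 < E ^+ 2 by rewrite exprn_gt0 // (lt_trans ltr01).
have E2 : 1 < E ^+ 2 by rewrite exprn_egt1.
have E3 : 0 < (E ^+ 2 - 1) * E ^+ 2 by rewrite mulr_gt0 // subr_gt0.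
have E4 := sqr_ge0 (E * E - 1).
by field; rewrite !gt_eqF //; lra.
Qed.

Lemma freq_decay s : (0 < s)%N -> freq s ^+ 2 = decay s ^+ 2 - pi ^+ 2 / 36.
Proof.
move=> s0; by rewrite freq2 // /decay !exprMn !sqr_sqrtr ?divr_ge0 //; field.
Qed.

Lemma sqrt_le_freq s : (0 < s)%N -> Num.sqrt s%:R <= freq s.
Proof.
move=> s0; have s1 : 1 <= s%:R :> R by rewrite ler1n.
have p2 := pi_ge2 R.
apply: le_trans (_ : Num.sqrt (freq s ^+ 2) <= _); last first.
  by rewrite sqrtr_sqr ger0_norm // ltW // freq_gt0.
rewrite ler_wsqrtr // freq2 //.
have : 2 ^+ 2 * (24 * s%:R - 1) <= pi ^+ 2 * (24 * s%:R - 1) :> R.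
  by rewrite ler_wpM2r ?lerXn2r ?nnegrE ?pi_ge0 //; lra.
by lra.
Qed.

(** The squares differ by pi^2 / 36 < 1 and the sum [decay s + freq s] is at least sqrt s. *)
Lemma freq_le_decay s : (0 < s)%N ->
  freq s <= decay s <= freq s + (Num.sqrt s%:R)^-1.
Proof.
move=> s0; have y0 := freq_gt0 s0; have d2 := freq_decay s0.
have ys := sqrt_le_freq s0; have p2 := pihalf_lt2 R; have pi0 := pi_gt0 R.
have r1 : 1 <= Num.sqrt s%:R :> R by rewrite -[leLHS]sqrtr1 ler_wsqrtr // ler1n.
have c0 : 0 <= decay s by rewrite !mulr_ge0 ?sqrtr_ge0 ?pi_ge0.
have pp : pi ^+ 2 <= 4 ^+ 2 :> R by rewrite lerXn2r ?nnegrE ?pi_ge0 //; lra.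
have yc : freq s <= decay s.
  by rewrite -(@ler_pXn2r _ 2%N) ?nnegrE ?(ltW y0) // d2 gerBl divr_ge0 ?sqr_ge0.
rewrite yc /= -lerBlDl -[leRHS]mul1r ler_pdivlMr ?(lt_le_trans ltr01 r1) //.
have : (decay s - freq s) * Num.sqrt s%:R <= (decay s - freq s) * (decay s + freq s).
  by rewrite ler_wpM2l ?subr_ge0 //; lra.
by move: pp; lra.
Qed.

Lemma ratio_bounds s : (0 < s)%N ->
  1 - (Num.sqrt s%:R)^-1 <= ratio s <=
  (1 + (Num.sqrt s%:R)^-1) * expR (Num.sqrt s%:R)^-1.
Proof.
move=> s0; have y0 := freq_gt0 s0.
have ys := sqrt_le_freq s0; have /andP[c1 c2] := freq_le_decay s0.
have r1 : 1 <= Num.sqrt s%:R :> R by rewrite -[leLHS]sqrtr1 ler_wsqrtr // ler1n.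
have r0 := lt_le_trans ltr01 r1.
rewrite /ratio; set q := expR _ ^+ 2; set d := (Num.sqrt _)^-1.
have d0 : 0 < d by rewrite invr_gt0.
have q0 : 0 < q by rewrite exprn_gt0 ?expR_gt0.
(* exp (2 y) >= 1 + 2 y >= sqrt s, where y = [freq s]. *)
have qd : q <= d.
  rewrite /q -expRM_natl mulrN expRN lef_pV2 ?posrE ?expR_gt0 //.
  by apply: le_trans (expR_ge1Dx _); lra.
have d1 : d <= 1 by rewrite invf_le1.
have qq : 0 <= q * (1 - q) by rewrite mulr_ge0 ?(ltW q0) //; lra.
have qD : 0 < 1 - q + q ^+ 2 by have := exprn_gt0 2 q0; lra.
have t1 : 1 - d <= (1 - q) / (1 - q + q ^+ 2).
  apply: le_trans (_ : 1 - q <= _); first by lra.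
  by rewrite ler_pdivlMr // ler_piMr; lra.
have t2 : (1 - q) / (1 - q + q ^+ 2) <= 1.
  by rewrite ler_pdivrMr // mul1r lerDl sqr_ge0.
have a1 : 1 <= decay s / freq s by rewrite ler_pdivlMr // mul1r.
have a2 : decay s / freq s <= 1 + d.
  rewrite ler_pdivrMr // mulrDl mul1r.
  apply: le_trans c2 _; rewrite lerD2l -/d ler_peMr ?(ltW d0) //; lra.
have b1 : 1 <= expR (decay s - freq s) by rewrite -expR0 ler_expR subr_ge0.
have b2 : expR (decay s - freq s) <= expR d by rewrite ler_expR lerBlDl.
move: (_ / _) (decay s / _) (expR (_ - _)) t1 t2 a1 a2 b1 b2 => t a b t1 t2 a1 a2 b1 b2.
clearbody d; have ab1 : 1 <= a * b by rewrite mulr_ege1.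
have t0 : 0 <= t by apply: le_trans t1; rewrite subr_ge0.
apply/andP; split; first by apply: le_trans t1 _; rewrite ler_peMl.
apply: le_trans (_ : a * b <= _); first by rewrite ler_piMr // (le_trans ler01).
by rewrite ler_pM ?(le_trans ler01 a1) ?(le_trans ler01 b1).
Qed.

End Pentagonal.

(** * The probability that one of finitely many variables is the largest *)

Section Increments.
Variable R : realType.

(* Both [f] and [g] are then Stieltjes primitives of [G] with respect to [h]. *)
Lemma eq_total_increment (h G f g : R -> R) (L : R) :
  (forall a b, 0 <= a <= b -> b <= 1 -> G b <= G a) ->
  (forall a b, 0 <= a <= b -> b <= 1 -> h b - h a <= L * (b - a)) ->
  (forall a b, 0 <= a <= b -> b <= 1 ->
     (h b - h a) * G b <= f b - f a <= (h b - h a) * G a) ->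
  (forall a b, 0 <= a <= b -> b <= 1 ->
     (h b - h a) * G b <= g b - g a <= (h b - h a) * G a) ->
  f 1 - f 0 = g 1 - g 0.
Proof.
move=> Gle hL fP gP; pose u x := f x - g x.
suff u01 : u 1 - u 0 = 0 by move: u01; rewrite /u; lra.
(* Cut [0, 1] into K + 1 equal pieces. On each, the increments of f and g differ by at most L / (K +
   1) times the drop of G, and the drops add up to G 0 - G 1. *)
have uP (K : nat) : `|u 1 - u 0| * K.+1%:R <= L * (G 0 - G 1).
  pose t (k : nat) : R := k%:R / K.+1%:R.
  have t0 : t 0%N = 0 by rewrite /t mul0r.
  have t1 : t K.+1 = 1 by rewrite /t mulfV.
  have sumu : \sum_(0 <= k < K.+1) (u (t k.+1) - u (t k)) = u 1 - u 0.
    by rewrite (telescope_sumr (fun k => u (t k))) // t0 t1.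
  have sumG : \sum_(0 <= k < K.+1) (G (t k) - G (t k.+1)) = G 0 - G 1.
    have := telescope_sumr (fun k => G (t k)) (leq0n K.+1).
    rewrite t0 t1 => GE; rewrite -[RHS]opprB -GE -sumrN.
    by apply: eq_bigr => k _; rewrite opprB.
  rewrite -sumG -sumu -ler_pdivlMr // mulrAC mulr_sumr.
  apply: le_trans (ler_norm_sum _ _ _) _.
  apply: ler_sum_nat => k /andP[_ kK].
  have tk : 0 <= t k <= t k.+1 by rewrite divr_ge0 //= ler_pM2r ?invr_gt0 // ler_nat.
  have tK : t k.+1 <= 1 by rewrite -t1 ler_pM2r ?invr_gt0 // ler_nat.
  have /andP[f1 f2] := fP _ _ tk tK; have /andP[g1 g2] := gP _ _ tk tK.
  have G1 := Gle _ _ tk tK; have := hL _ _ tk tK.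
  rewrite -mulrBl -natrB // subSnn mul1r => hh.
  have : (h (t k.+1) - h (t k)) * (G (t k) - G (t k.+1)) <=
      L / K.+1%:R * (G (t k) - G (t k.+1)) by rewrite ler_wpM2r // subr_ge0.
  move: f1 f2 g1 g2; rewrite ler_norml /u.
  move: (L / _) (h (t k.+1)) (h (t k)) (G (t k.+1)) (G (t k)) (f (t k.+1)) (f (t k))
    (g (t k.+1)) (g (t k)) => c h1 h0 G1' G0' f1' f0' g1' g0' *.
  by apply/andP; split; lra.
apply/eqP; rewrite -normr_le0 leNgt; apply/negP => u0.
have := archi_boundP (_ : 0 <= `|L * (G 0 - G 1) / `|u 1 - u 0| |).
move=> /(_ (normr_ge0 _)); set K := Num.bound _ => KP.
have := uP K; rewrite mulrC -ler_pdivlMr // leNgt => /negP; apply.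
apply: le_lt_trans (ler_norm _) (lt_trans KP _).
by rewrite ltr_nat.
Qed.

End Increments.

Section ExponentialMaximum.
Context (R : realType) (d : measure_display) (T : measurableType d).
Context (P : probability T R).

Definition pr (A : set T) : R := fine (P A).

Lemma prK A : measurable A -> (pr A)%:E = P A.
Proof. by move=> mA; rewrite /pr fineK // fin_num_measure. Qed.

Lemma pr_le A B : measurable A -> measurable B -> A `<=` B -> pr A <= pr B.
Proof.
by move=> mA mB AB; rewrite -lee_fin !prK // le_measure ?inE.
Qed.

Lemma prD A B : measurable A -> measurable B -> B `<=` A -> pr (A `\` B) = pr A - pr B.
Proof.
move=> mA mB BA; apply/EFin_inj; rewrite prK ?EFinB ?prK //; last exact: measurableD.
rewrite measureD //; first by rewrite setIidr.
by rewrite ltey_eq fin_num_measure.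
Qed.

(** The event V >= t for V = exp (- x). With this parameter in [0, 1], t = 0 gives the whole line
    without an infinite endpoint. *)
Definition level (t : R) : set R := [set x | t <= expR (- x)].

Lemma level0 : level 0 = setT.
Proof. by apply/seteqP; split=> // x _; exact: expR_ge0. Qed.

Lemma levelE t : 0 < t -> level t = `]-oo, (- ln t)]%classic.
Proof.
move=> t0; apply/seteqP; split => x; rewrite /level /= in_itv /= => h.
  by rewrite lerNr -ler_expR lnK ?posrE.
by rewrite -[leLHS]lnK ?posrE // ler_expR lerNr.
Qed.

Lemma measurable_level t : 0 <= t -> measurable (level t).
Proof.
rewrite le_eqVlt => /orP[/eqP <-|/levelE ->]; last exact: measurable_itv.
by rewrite level0.
Qed.

Lemma level_le a b : a <= b -> level b `<=` level a.
Proof. by move=> ab x; exact: le_trans. Qed.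

Lemma exponential_level (Y : {RV P >-> R}) (n : nat) t : (0 < n)%N ->
  (forall A, measurable A -> distribution P Y A = exponential_prob n%:R A) ->
  0 <= t <= 1 -> pr (Y @^-1` level t) = 1 - t ^+ n.
Proof.
move=> n0 YP /andP[]; rewrite le_eqVlt => /orP[/eqP <- _|t0 t1].
  by rewrite level0 preimage_setT /pr probability_setT expr0n eqn0Ngt n0 subr0.
(* The density vanishes on negative reals, so the half-line may be cut down to [0, - ln t]; t = 1,
   where this is a single point, is treated apart. *)
have neg0 : distribution P Y `]-oo, 0[%classic = 0%E.
  rewrite YP // /exponential_prob integral0_eq // => x; rewrite /= in_itv /= => x0.
  by rewrite lt0_exponential_pdf.
have l0 : 0 <= - ln t by rewrite oppr_ge0 ln_le0.
have -> : pr (Y @^-1` level t) = fine (distribution P Y `[0, (- ln t)]%classic).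
  rewrite /pr -/(distribution P Y _) levelE //.
  rewrite -(measureU0 (mu := distribution P Y) _ _ neg0) //.
  congr (fine (distribution P Y _)); apply/seteqP; split => x /=;
    rewrite !in_itv /=; first by case: (ltP x 0) => ? ->; [right|left].
  by case=> [/andP[]|/ltW/le_trans ->].
rewrite YP //; move: l0; rewrite le_eqVlt => /orP[/eqP l0|l0].
  have lnt0 : ln t = 0 by lra.
  have : expR (ln t) = 1 by rewrite lnt0 expR0.
  rewrite lnK ?posrE // => ->.
  by rewrite ln1 oppr0 set_itv1 /exponential_prob integral_set1 expr1n subrr.
rewrite exponential_prob_itv0c //= mulrNN expRM_natl lnK ?posrE //.
Qed.

Definition fprod_but (N m : nat) : {poly R} :=
  \prod_(1 <= i < N.+1 | i != m) (1 - 'X^i).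

Variable X : nat -> {RV P >-> R}.
Hypothesis indX : mutually_independent_RVs P [set i | (0 < i)%N] X.
Hypothesis expX : forall i : nat, (0 < i)%N -> forall A : set R, measurable A ->
  distribution P (X i) A = exponential_prob i%:R A.

Definition is_max (N m : nat) : set T :=
  [set w | forall i, (0 < i <= N)%N -> X i w <= X m w].

Lemma measurable_is_max N m : measurable (is_max N m).
Proof.
rewrite (_ : is_max N m = \bigcap_(i in [set i | (0 < i <= N)%N])
  ((fun w => X m w - X i w) @^-1` `[0, +oo[)); last first.
  by apply/seteqP; split => w h i iN; have := h i iN;
    rewrite /= in_itv /= andbT subr_ge0.
apply: bigcap_measurableType => i _.
rewrite -[X in measurable X]setTI.
by apply: (measurable_funB (measurable_funP _) (measurable_funP _)).
Qed.

Lemma measurable_level_preimage i t : 0 <= t -> measurable (X i @^-1` level t).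
Proof.
move=> t0; exact: measurable_funPTI (measurable_level t0).
Qed.

(** V_m lies in [a, b) and the other V_i are at least c. The cells with c = b and c = a enclose,
    from inside and outside, the event that X_m is the largest and V_m is in [a, b). *)
Definition cell (N m : nat) (a b c : R) : set T :=
  [set w | [/\ a <= expR (- X m w), expR (- X m w) < b &
    forall i, (0 < i <= N)%N -> i != m -> c <= expR (- X i w)]].

Lemma pr_cell N m a b c : (0 < m <= N)%N ->
  0 <= a <= b -> b <= 1 -> 0 <= c <= 1 ->
  measurable (cell N m a b c) /\
  pr (cell N m a b c) = (b ^+ m - a ^+ m) * (fprod_but N m).[c].
Proof.
move=> /andP[m0 mN] /andP[a0 ab] b1 c01.
pose J : {fset nat} := [fset i in index_iota 1 N.+1]%fset.
pose B i : set R := if i == m then level a `\` level b else level c.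
have mB i : measurable (B i).
  have /andP[c0 _] := c01; have b0 := le_trans a0 ab.
  by rewrite /B; case: ifP => _; [apply: measurableD|]; apply: measurable_level.
have JE i : (i \in J) = (0 < i <= N)%N.
  by rewrite /J !inE /= mem_index_iota.
have cE : cell N m a b c = \bigcap_(j in [set` J]) (X j @^-1` B j).
  apply/seteqP; split => w.
    move=> [wa wb wc] j /=; rewrite JE => jN; rewrite /B; case: eqP => [->|/eqP jm] /=.
      by split => //; apply/negP; rewrite -ltNge.
    exact: wc.
  move=> h; have := h m; rewrite /= JE m0 mN /B eqxx => /(_ isT)[wa /negP].
  rewrite -ltNge => wb; split => // i iN im; have := h i.
  by rewrite /= JE iN /B (negPf im) => /(_ isT).
have mXB j : measurable (X j @^-1` B j).
  exact: measurable_funPTI (mB j).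
split.
  by rewrite cE; apply: bigcap_measurableType.
rewrite {1}/pr cE indX; last 2 first.
- by move=> j /=; rewrite JE => /andP[].
- by move=> j _.
rewrite (perm_big (index_iota 1 N.+1)) /=; last first.
  apply: uniq_perm; rewrite ?fset_uniq ?iota_uniq // => i.
  by rewrite JE mem_index_iota.
rewrite (eq_bigr (fun j => (pr (X j @^-1` B j))%:E)); last by move=> j _; rewrite prK.
rewrite prodEFin /= (bigD1_seq m) ?iota_uniq ?mem_index_iota ?m0 //=.
congr (_ * _).
  rewrite /B eqxx (_ : X m @^-1` _ = X m @^-1` level a `\` X m @^-1` level b) //.
  rewrite prD; last 3 first.
  - exact: measurable_level_preimage.
  - by apply: measurable_level_preimage; exact: le_trans ab.
  - by move=> w; exact: level_le.
  rewrite !(exponential_level m0 (expX m0)); first by ring.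
  - by rewrite (le_trans a0).
  - by rewrite a0 (le_trans ab).
rewrite /fprod_but horner_prod big_seq_cond [RHS]big_seq_cond.
apply: eq_bigr => i /andP[]; rewrite mem_index_iota => /andP[i0 _] im.
by rewrite /B (negPf im) (exponential_level i0 (expX i0)) // !hornerE.
Qed.

Lemma fprod_but_le N m a b : 0 <= a <= b -> b <= 1 ->
  0 <= (fprod_but N m).[b] <= (fprod_but N m).[a].
Proof.
move=> /andP[a0 ab] b1; have b0 := le_trans a0 ab; rewrite /fprod_but !horner_prod.
have f0 i : 0 <= (1 - 'X^i : {poly R}).[b] by rewrite !hornerE subr_ge0 exprn_ile1.
rewrite prodr_ge0 //=; apply: ler_prod => i _; rewrite f0 /= !hornerE lerB //.
by rewrite lerXn2r ?nnegrE.
Qed.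

Lemma prim_increment m a b : (0 < m)%N ->
  m%:R * ((prim ('X^(m.-1) : {poly R})).[b] - (prim 'X^(m.-1)).[a]) = b ^+ m - a ^+ m.
Proof.
move=> m0; rewrite primXn prednK // !hornerE -mulrBr mulrA mulfV ?mul1r //.
by rewrite pnatr_eq0 -lt0n.
Qed.

(** Both [f t], the probability that X_m is the largest and V_m < t, and m times the primitive of
    ['X^(m-1) * F] have increments on [a, b] between (b^m - a^m) F(b) and (b^m - a^m) F(a). Then
    [eq_total_increment] applies, with Lipschitz constant m for t^m. *)
Lemma pr_is_max N m : (0 < m <= N)%N ->
  pr (is_max N m) = m%:R * int01 ('X^(m.-1) * fprod_but N m).
Proof.
move=> mN; have /andP[m0 _] := mN.
set F := fprod_but N m; pose U t := m%:R * (prim ('X^(m.-1) * F)).[t].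
pose lv t : set T := X m @^-1` level t.
pose E := is_max N m; have mE : measurable E by exact: measurable_is_max.
have mlv t : 0 <= t -> measurable (lv t) by exact: measurable_level_preimage.
pose f t := pr (E `\` lv t).
(* V_m < 1 almost surely, so [f 1] is the whole probability. *)
have lv01 : pr (lv 1) = 0.
  by rewrite (exponential_level m0 (expX m0)) ?expr1n ?subrr // ler01 lexx.
have f0 : f 0 = 0 by rewrite /f /lv level0 preimage_setT setDT /pr measure0.
have f1 : f 1 = pr E.
  have -> : f 1 = pr (E `\` (E `&` lv 1)) by rewrite /f setDIr setDv set0U.
  have mI : measurable (E `&` lv 1) by apply: measurableI => //; exact: mlv.
  rewrite prD //.
  suff -> : pr (E `&` lv 1) = 0 by rewrite subr0.
  apply/eqP; rewrite eq_le fine_ge0 ?measure_ge0 // andbT -lv01.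
  by apply: pr_le => //; exact: mlv.
have U0 : U 0 = 0 by rewrite /U prim_horner0 mulr0.
suff : f 1 - f 0 = U 1 - U 0 by rewrite f0 f1 U0 !subr0.
apply: (@eq_total_increment _ (fun t => t ^+ m) (fun t => F.[t]) f U m%:R).
- by move=> a b ab b1; have /andP[] := fprod_but_le N m ab b1.
- move=> a b /andP[a0 ab] b1; rewrite -prim_increment // ler_wpM2l //.
  have := @prim_le R ('X^(m.-1)) 'X^0 a b ab.
  rewrite (primXn _ 0) !hornerE invr1 !mul1r; apply => x /andP[ax xb].
  by rewrite hornerXn hornerC exprn_ile1 // ?(le_trans a0) ?(le_trans xb).
- move=> a b ab b1; have /andP[a0 ab'] := ab; have b0 := le_trans a0 ab'.
  have a1 := le_trans ab' b1.
  have b01 : 0 <= b <= 1 by rewrite b0.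
  have a01 : 0 <= a <= 1 by rewrite a0.
  have [mc1 <-] := pr_cell mN ab b1 b01; have [mc2 <-] := pr_cell mN ab b1 a01.
  have mD t : 0 <= t -> measurable (E `\` lv t).
    by move=> t0; apply: measurableD => //; exact: mlv.
  have sD : E `\` lv a `<=` E `\` lv b.
    by apply: setDS; move=> w; exact: level_le.
  have -> : f b - f a = pr ((E `\` lv b) `\` (E `\` lv a)).
    by rewrite prD //; exact: mD.
  have mDD : measurable ((E `\` lv b) `\` (E `\` lv a)).
    by apply: measurableD; exact: mD.
  apply/andP; split; apply: pr_le => //.
  + move=> w [wa wb wc]; split; last by move=> [_]; apply.
    split; last by apply/negP; rewrite -ltNge.
    move=> i iN; have [->//|im] := eqVneq i m.
    rewrite -lerN2 -ler_expR; apply: le_trans (wc i iN im); exact: ltW.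
  + move=> w [[wE wb] wna].
    have wa : lv a w by apply: contrapT => h; apply: wna; split.
    split=> //; first by rewrite ltNge; apply/negP.
    move=> i iN im; apply: le_trans wa _.
    by rewrite ler_expR lerN2; exact: wE.
- move=> a b ab b1; have /andP[a0 ab'] := ab; have b0 := le_trans a0 ab'.
  rewrite /U -mulrBr -prim_increment // -!mulrA.
  have cst c : ((prim ('X^(m.-1) : {poly R})).[b] - (prim 'X^(m.-1)).[a]) * c =
      (prim ('X^(m.-1) * c%:P)).[b] - (prim ('X^(m.-1) * c%:P)).[a].
    have primC : prim ('X^(m.-1) * c%:P) = c *: prim 'X^(m.-1).
      by apply/polyP => i; rewrite (mulrC 'X^(m.-1)) !(coef_prim, coefZ) coefCM mulrA.
    by rewrite primC !hornerE -mulrBr mulrC.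
  rewrite !cst; apply/andP; split; rewrite ler_wpM2l //; apply: prim_le => // x /andP[ax xb];
    rewrite !hornerM !hornerC ler_wpM2l ?hornerXn ?exprn_ge0 ?(le_trans a0) //.
  + have x0b : 0 <= x <= b by rewrite xb (le_trans a0).
    by have /andP[] := fprod_but_le N m x0b b1.
  + have a0x : 0 <= a <= x by rewrite a0.
    by have /andP[] := fprod_but_le N m a0x (le_trans xb b1).
Qed.

Lemma pr_is_max_cvg m :
  pr (is_max N m) @[N --> \oo] --> pr [set w | forall i, (0 < i)%N -> X i w <= X m w].
Proof.
have cap : [set w | forall i, (0 < i)%N -> X i w <= X m w] = \bigcap_N is_max N m.
  apply/seteqP; split => w h; first by move=> N _ i /andP[i0 _]; exact: h.
  by move=> i i0; apply: (h i) => //; rewrite i0 leqnn.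
rewrite cap /pr; apply: fine_cvg; rewrite fineK; last first.
  apply: fin_num_measure; apply: bigcap_measurableType => N _; exact: measurable_is_max.
apply: nonincreasing_cvg_mu.
- by rewrite ltey_eq fin_num_measure //; exact: measurable_is_max.
- by move=> N; exact: measurable_is_max.
- by apply: bigcap_measurableType => N _; exact: measurable_is_max.
- move=> N M NM; apply/subsetPset => w h i /andP[i0 iN]; apply: h.
  by rewrite i0 (leq_trans iN).
Qed.

End ExponentialMaximum.

(** * Domination by the leading term *)

Section Tail.
Variable R : realType.

Lemma qtail_fprod N m : (0 < m <= N)%N ->
  qtail R N 0 = (1 - 'X^m) * fprod_but R N m.
Proof.
by move=> mN; rewrite /qtail (bigD1_seq m) ?iota_uniq ?mem_index_iota.
Qed.

(* The geometric expansion of [1 / (1 - X^m)], truncated at order [J]. *)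
Lemma max_laplaceM N m J : (0 < m <= N)%N ->
  \sum_(0 <= j < J) laplaceM R N (j.+1 * m) / j.+1%:R <=
  m%:R * int01 ('X^(m.-1) * fprod_but R N m) <=
  \sum_(0 <= j < J) laplaceM R N (j.+1 * m) / j.+1%:R + J.+1%:R^-1.
Proof.
move=> mN; have /andP[m0 _] := mN; have m1 : (m%:R : R) != 0 by rewrite pnatr_eq0 -lt0n.
(* What remains after J terms; it lies between 0 and 1 / (J + 1) because [fprod_but] takes values in
   [0, 1]. *)
pose rest : R := m%:R * int01 ('X^((J.+1 * m).-1) * fprod_but R N m).
have -> : m%:R * int01 ('X^(m.-1) * fprod_but R N m) =
    \sum_(0 <= j < J) laplaceM R N (j.+1 * m) / j.+1%:R + rest.
  rewrite {}/rest; elim: J => [|J ->]; first by rewrite big_geq // add0r mul1n.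
  rewrite big_nat_recr //= -addrA; congr (_ + _).
  rewrite /laplaceM (qtail_fprod mN) natrM mulrAC [_ * m%:R]mulrC mulfK ?pnatr_eq0 //.
  rewrite -mulrDr -raddfD /=; congr (_ * int01 _).
  rewrite [((J.+2 * m).-1)%N](_ : _ = (J.+1 * m).-1 + m)%N; last by lia.
  by rewrite exprD; ring.
rewrite lerDl lerD2l; apply/andP; split.
  rewrite mulr_ge0 // int01_ge0 // => x /andP[x0 x1].
  have x11 : 0 <= x <= 1 by rewrite x0.
  have /andP[h _] := fprod_but_le N m x11 (lexx 1).
  have x1b : 0 <= x <= x by rewrite x0 lexx.
  have /andP[h' _] := fprod_but_le N m x1b x1.
  by rewrite hornerM hornerXn mulr_ge0 ?exprn_ge0.
apply: le_trans (_ : m%:R * int01 'X^((J.+1 * m).-1) <= _).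
  rewrite ler_wpM2l //; apply: int01_le => x /andP[x0 x1].
  have x0b : 0 <= (0 : R) <= x by rewrite lexx x0.
  have /andP[_ h] := fprod_but_le N m x0b x1.
  rewrite hornerM !hornerXn ler_piMr ?exprn_ge0 // (le_trans h) //.
  rewrite /fprod_but horner_prod prodr_ile1 // => i _.
  by rewrite !hornerE subr_ge0 gerBl exprn_ile1 ?exprn_ge0.
by rewrite int01Xn prednK ?muln_gt0 ?m0 // natrM invfM mulrCA mulfV // mulr1.
Qed.

(** The exponent gains at least z = sqrt (j m) / 4, and exp (- z) <= 24 / z^4 supplies both the
    factor m^-2 and a summable j^-2; the growth sqrt j of the prefactor is absorbed by 1 / j. *)
Lemma target_le j m : (1 < j)%N -> (0 < m)%N ->
  target R (j * m) / j%:R <= 24 * 4 ^+ 4 / m%:R ^+ 2 * target R m / j%:R ^+ 2.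
Proof.
move=> j1 m0; have j0 : (0 < j)%N by exact: ltnW.
have jR : 0 < j%:R :> R by rewrite ltr0n.
have mR : 0 < m%:R :> R by rewrite ltr0n.
have T0 := target_gt0 R m0.
set a : R := Num.sqrt m%:R; set b : R := Num.sqrt j%:R.
have a0 : 0 < a by rewrite sqrtr_gt0.
have b2 : b ^+ 2 = j%:R by rewrite sqr_sqrtr.
have a2 : a ^+ 2 = m%:R by rewrite sqr_sqrtr.
have b0 : 0 < b by rewrite sqrtr_gt0.
(* This is where j >= 2 enters: it gives b - 1 >= b / 4. *)
have b43 : 4 / 3 <= b.
  rewrite -(@ler_pXn2r _ 2%N) ?nnegrE ?(ltW b0) // b2.
  have : 2 <= j%:R :> R by rewrite ler_nat.
  by lra.
pose z := a * b / 4; have z0 : 0 < z by rewrite divr_gt0 ?mulr_gt0.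
have k1 : 1 <= pi * Num.sqrt (2 / 3) :> R.
  rewrite -(@ler_pXn2r _ 2%N) ?nnegrE ?mulr_ge0 ?sqrtr_ge0 ?pi_ge0 //.
  rewrite expr1n exprMn sqr_sqrtr ?divr_ge0 //.
  have : 2 ^+ 2 <= pi ^+ 2 :> R by rewrite lerXn2r ?nnegrE ?pi_ge0 ?pi_ge2.
  by lra.
have TE : target R (j * m) =
    b * target R m * expR (- (pi * Num.sqrt (2 / 3) * a * (b - 1))).
  have -> : target R (j * m) = pi * (b * Num.sqrt (2 * m%:R)) *
      expR (- (pi * Num.sqrt (2 / 3)) * (b * a)).
    by rewrite /target natrM [X in Num.sqrt X]mulrCA !(sqrtrM _ (ltW jR)).
  rewrite /target -/a [RHS](_ : _ = pi * (b * Num.sqrt (2 * m%:R)) *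
    (expR (- (pi * Num.sqrt (2 / 3)) * a) *
     expR (- (pi * Num.sqrt (2 / 3) * a * (b - 1))))); last by ring.
  by rewrite -expRD; congr (_ * expR _); ring.
have ez : expR (- (pi * Num.sqrt (2 / 3) * a * (b - 1))) <= 24 / z ^+ 4.
  apply: le_trans (_ : expR (- z) <= _).
    rewrite ler_expR lerN2; apply: le_trans (_ : 1 * a * (b - 1) <= _).
      rewrite mul1r /z -mulrA ler_wpM2l ?(ltW a0) //.
      by move: b43; clear; lra.
    have b1 : 0 <= b - 1 by move: b43; clear; lra.
    by rewrite ler_wpM2r // ler_wpM2r // ltW.
  rewrite expRN -[leRHS]invf_div lef_pV2 ?posrE ?expR_gt0 ?divr_gt0 ?exprn_gt0 //.
  have := @expR_ge1Dxn _ z 3 (ltW z0); rewrite (_ : (4`!)%:R = 24 :> R) //.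
  by apply: le_trans; rewrite lerDr.
have b1 : 1 <= b by move: b43; clear; lra.
have bj : b / j%:R <= 1.
  by rewrite -b2 ler_pdivrMr ?exprn_gt0 // mul1r expr2 ler_peMl // ltW.
rewrite TE [leRHS](_ : _ = target R m * (24 / z ^+ 4)); last first.
  by rewrite /z -b2 -a2; field; rewrite !lt0r_neq0.
rewrite [leLHS](_ : _ = target R m *
  (b / j%:R * expR (- (pi * Num.sqrt (2 / 3) * a * (b - 1))))); last by ring.
by rewrite ler_wpM2l ?(ltW T0) //; apply: le_trans ez; rewrite ler_piMl ?expR_ge0.
Qed.

Lemma sum_inv_sqr_le J : \sum_(1 <= j < J.+1) (j.+1%:R ^+ 2)^-1 <= 1 :> R.
Proof.
(* Strengthened so that the induction goes through, by comparison with a telescoping sum. *)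
suff : \sum_(1 <= j < J.+1) (j.+1%:R ^+ 2)^-1 <= 1 - J.+1%:R^-1 :> R.
  by move=> h; apply: le_trans h _; rewrite gerBl invr_ge0.
elim: J => [|J IH]; first by rewrite big_geq // invr1 subrr.
rewrite big_nat_recr //=; apply: le_trans (lerD IH (lexx _)) _.
have J0 : 0 < J.+1%:R :> R by [].
rewrite -(natr1 J.+1); move: (J.+1%:R) J0 => x x0.
rewrite -subr_ge0 (_ : _ - _ = (x * (x + 1) ^+ 2)^-1).
  by rewrite invr_ge0 mulr_ge0 ?sqr_ge0 // ltW.
by field; rewrite !lt0r_neq0 //; lra.
Qed.

(** [target_le] handles the main factor, and [ratio] is at most 2 e because sqrt s >= 1 in
    [ratio_bounds]. *)
Lemma tail_le m J : (0 < m)%N ->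
  \sum_(1 <= j < J.+1) laplaceM_lim R (j.+1 * m) / j.+1%:R <=
  24 * 4 ^+ 4 * (2 * expR 1) / m%:R ^+ 2 * target R m.
Proof.
move=> m0; have T0 := target_gt0 R m0.
have B0 : 0 <= 2 * expR 1 :> R by rewrite mulr_ge0 ?expR_ge0.
set c : R := _ / _ * _.
have c0 : 0 <= c.
  apply: mulr_ge0 (ltW T0); apply: divr_ge0 (sqr_ge0 _); apply: mulr_ge0 B0.
  by apply: mulr_ge0; rewrite ?exprn_ge0.
apply: le_trans (_ : \sum_(1 <= j < J.+1) c * (j.+1%:R ^+ 2)^-1 <= _); last first.
  by rewrite -mulr_sumr ler_piMr // sum_inv_sqr_le.
apply: ler_sum_nat => j /andP[j1 _].
have s0 : (0 < j.+1 * m)%N by rewrite muln_gt0.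
have r1 : 1 <= Num.sqrt (j.+1 * m)%:R :> R by rewrite -[leLHS]sqrtr1 ler_wsqrtr // ler1n.
have ratio_le : ratio R (j.+1 * m) <= 2 * expR 1.
  have /andP[_ /le_trans] := ratio_bounds R s0; apply.
  have d1 : (Num.sqrt (j.+1 * m)%:R)^-1 <= 1 :> R.
    by rewrite invf_le1 // (lt_le_trans ltr01).
  have d0 : 0 <= (Num.sqrt (j.+1 * m)%:R)^-1 :> R by rewrite invr_ge0 sqrtr_ge0.
  by rewrite ler_pM ?expR_ge0 ?ler_expR //; lra.
rewrite laplaceM_limE // mulrAC.
apply: le_trans (_ : target R (j.+1 * m) / j.+1%:R * (2 * expR 1) <= _).
  by rewrite ler_wpM2l // divr_ge0 // ltW // target_gt0.
have := @target_le j.+1 m j1 m0.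
move/(ler_wpM2r B0)/le_trans; apply.
rewrite /c le_eqVlt; apply/orP; left; apply/eqP; ring.
Qed.

End Tail.

(** * Passage to the limit and squeeze *)

Theorem theorem6 (R : realType) (d : measure_display) (T : measurableType d)
  (P : probability T R) (X : nat -> {RV P >-> R}) :
  mutually_independent_RVs P [set i | (0 < i)%N] X ->
  (forall i : nat, (0 < i)%N -> forall A : set R, measurable A ->
     distribution P (X i) A = exponential_prob i%:R A) ->
  (fun m : nat =>
     fine (P [set w | forall i : nat, (0 < i)%N -> X i w <= X m w]) /
     (pi * Num.sqrt (2 * m%:R) *
      expR (- (pi * Num.sqrt (2 / 3)) * Num.sqrt m%:R)))
    @ \oo --> (1 : R).
Proof.
move=> indX expX.
pose p m := pr P [set w | forall i : nat, (0 < i)%N -> X i w <= X m w].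
(* Let N go to infinity along [half3] with J fixed, so that only finite sums are passed to the
   limit. *)
have p_bounds m J : (0 < m)%N ->
    \sum_(0 <= j < J) laplaceM_lim R (j.+1 * m) / j.+1%:R <= p m <=
    \sum_(0 <= j < J) laplaceM_lim R (j.+1 * m) / j.+1%:R + J.+1%:R^-1.
  move=> m0.
  have pc : pr P (is_max X (half3 r) m) @[r --> \oo] --> p m.
    by apply: (cvg_comp half3 (fun N => pr P (is_max X N m)) half3_cvg);
      exact: pr_is_max_cvg.
  have sc : \sum_(0 <= j < J) laplaceM R (half3 r) (j.+1 * m) / j.+1%:R @[r --> \oo] -->
      \sum_(0 <= j < J) laplaceM_lim R (j.+1 * m) / j.+1%:R.
    apply: (@cvg_big _ _ _ _ _ add_continuous) => j _.
    by apply: cvgMl; apply: laplaceM_cvg; rewrite muln_gt0.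
  have bd r : (m <= r)%N ->
      \sum_(0 <= j < J) laplaceM R (half3 r) (j.+1 * m) / j.+1%:R <=
      pr P (is_max X (half3 r) m) <=
      \sum_(0 <= j < J) laplaceM R (half3 r) (j.+1 * m) / j.+1%:R + J.+1%:R^-1.
    move=> mr; have mN : (0 < m <= half3 r)%N by rewrite m0 (leq_trans mr) ?half3_ge.
    by rewrite (pr_is_max indX expX mN) max_laplaceM.
  apply/andP; split.
    by apply: ler_cvg_to sc pc _; exists m => // r /= /bd /andP[].
  apply: ler_cvg_to pc (cvgD sc (cvg_cst _)) _.
  by exists m => // r /= /bd /andP[].
pose C : R := 24 * 4 ^+ 4 * (2 * expR 1).
have p_upper m : (0 < m)%N -> p m <= laplaceM_lim R m + C / m%:R ^+ 2 * target R m.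
  move=> m0; rewrite -[leRHS]addr0.
  have hc : laplaceM_lim R m + C / m%:R ^+ 2 * target R m + n.+1%:R^-1 @[n --> \oo] -->
      laplaceM_lim R m + C / m%:R ^+ 2 * target R m + 0.
    by apply: cvgD; [exact: cvg_cst|exact: cvg_harmonic].
  apply: ler_cvg_to (cvg_cst (p m)) hc _; exists 0%N => // n _ /=.
  (* J = n + 1 lets the leading term be split off; the error 1 / (n + 2) is at most 1 / (n + 1). *)
  have /andP[_ /le_trans] := p_bounds m n.+1 m0; apply.
  rewrite big_ltn // mul1n divr1 -addrA -[leRHS]addrA lerD2l lerD //; last first.
    by rewrite lef_pV2 ?posrE // ler_nat.
  exact: tail_le.
pose dl m : R := (Num.sqrt m%:R)^-1.
have dl0 : dl m @[m --> \oo] --> (0 : R) by exact: invsqrt_cvg0.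
apply: (@squeeze_cvgr _ _ _ _ (fun m => 1 - dl m)
  (fun m => (1 + dl m) * expR (dl m) + C * dl m)).
- exists 1%N => // m /= m0; have T0 := target_gt0 R m0.
  have m1 : 1 <= m%:R :> R by rewrite ler1n.
  rewrite -/(target R m) -/(pr P _) -/(p m).
  have /andP[r1 r2] := ratio_bounds R m0.
  rewrite ler_pdivlMr // ler_pdivrMr //; apply/andP; split.
    (* For the lower bound the leading term alone suffices. *)
    have /andP[h _] := p_bounds m 1%N m0.
    apply: le_trans h; rewrite big_nat1 mul1n divr1 laplaceM_limE //.
    by rewrite [leRHS]mulrC ler_wpM2r // ltW.
  apply: le_trans (p_upper m m0) _; rewrite laplaceM_limE // [target R m * _]mulrC.
  rewrite -mulrDl ler_wpM2r ?(ltW T0) // lerD //.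
  have mR : 0 < m%:R :> R by exact: lt_le_trans ltr01 m1.
  rewrite ler_wpM2l ?mulr_ge0 ?expR_ge0 // lef_pV2 ?posrE ?sqrtr_gt0 ?exprn_gt0 //.
  rewrite -[leRHS]ger0_norm ?sqr_ge0 // -sqrtr_sqr ler_wsqrtr //.
  by rewrite -exprM -[leLHS]expr1 ler_weXn2l.
- by rewrite -[X in _ --> X]subr0; apply: cvgB => //; exact: cvg_cst.
- rewrite -[X in _ --> X](_ : (1 + 0) * expR 0 + C * 0 = 1); last first.
    by rewrite expR0 mulr0 !addr0 mulr1.
  apply: cvgD; last exact: cvgMr.
  apply: cvgM; first by apply: cvgD => //; exact: cvg_cst.
  by apply: (cvg_comp dl expR dl0); exact: continuous_expR.
Qed.
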